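(* There exists a constant $c>0$ such that for every integer $n\ge 2$ and every integer $r$ with $0\le r\le\lceil n/3\rceil$ there exists a graph $G$ with $n$ vertices and rank-width at most $r$ such that $\Gamma_{\mathrm{CZ}}(|G\rangle)\ge c\,rn/\log n$.
   Context: Graphs are finite, simple and undirected. The Pauli group $\mathcal{G}_n$ consists of all $\alpha h_1\otimes\dots\otimes h_n$ with $\alpha\in\{\pm1,\pm i\}$, $h_j\in\{I_2,X,Y,Z\}$. The $n$-qubit Clifford group is $\mathcal{C}_n=\{U\in U(2^n): U\mathcal{G}_nU^\dagger=\mathcal{G}_n\}$. For a graph $G=(V,E)$ with $V=\{1,\dots,n\}$, the graph state $|G\rangle$ is the $n$-qubit state (unique up to global phase) that is fixed by $X_v\otimes\bigotimes_{w\in N_G(v)}Z_w$ for all $v\in V$. States are considered up to global phase. CZ-complexity: a quantum algorithm consists of (1) measurements of qubits in the computational basis (measured qubits are discarded); (2) single-qubit Clifford operations; (3) two-qubit Clifford operations (elements of $\mathcal{C}_2$ applied to any pair of qubits); later operations may depend on earlier measurement outcomes. Its CZ-complexity is the maximum, over measurement outcomes, of the number of two-qubit Clifford operations. $\Gamma_{\mathrm{CZ}}(|G\rangle)$ is the minimum CZ-complexity of an algorithm that generates $|G\rangle$ from $|0\rangle^{\otimes(n+s)}$ with probability $1$ for some $s\ge0$. Rank-width: for $S\subseteq V$, $\mathrm{cutrank}_G(S)$ is the rank over $\mathbb{F}_2$ of the $S\times(V\setminus S)$ submatrix of the adjacency matrix of $G$ (zero for $S=\varnothing$). A rank-decomposition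 of $G$ is a pair $(T,L)$ with $T$ a tree of maximum degree at most three with at least two vertices and $L$ a bijection from $V$ to the leaves of $T$. Each edge $e$ of $T$ induces a partition $\{S,V\setminus S\}$ of $V$ (via the leaves of the two components of $T-e$); the width of $e$ is $\mathrm{cutrank}_G(S)$, and the width of $(T,L)$ is the maximum width of its edges. The rank-width of $G$ is the minimum width over all rank-decompositions (and $0$ if $G$ has at most one vertex). *)

(* Defs.v *)
From HB Require Import structures.
From mathcomp Require Export all_boot all_order all_algebra.
From mathcomp Require Export sesquilinear spectral.
From mathcomp Require Export complex.
From mathcomp Require Export all_classical all_reals all_analysis.

Set Implicit Arguments.
Unset Strict Implicit.
Unset Printing Implicit Defensive.

Export Order.TTheory GRing.Theory Num.Theory.

Local Open Scope classical_set_scope.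
Local Open Scope ring_scope.
Local Open Scope sesquilinear_scope.

Record sgraph (V : finType) := SGraph {
  adj :> rel V;
  adj_sym : symmetric adj;
  adj_irrefl : irreflexive adj
}.

(* The minimum of a set of naturals; +oo if the set is empty. *)
Definition min_value (R : realType) (A : set nat) : \bar R :=
  ereal_inf [set (k%:R)%:E | k in A].

Definition degree (V : finType) (G : sgraph V) (x : V) : nat :=
  #|[pred y | G x y]|.

Definition is_tree (V : finType) (T : sgraph V) : Prop :=
  (forall x y, connect T x y) /\ (forall c : seq V, (2 < size c)%N -> ~ ucycle T c).

Definition cutrank (V : finType) (G : sgraph V) (S : {set V}) : nat :=
  \rank (\matrix_(i < #|S|, j < #|~: S|)
           ((G (enum_val i) (enum_val j))%:R : 'F_2)).

Record rank_decomposition (V : finType) := RankDecomposition {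
  rd_node : finType;
  rd_tree : sgraph rd_node;
  rd_leaf : V -> rd_node;
  rd_is_tree : is_tree rd_tree;
  rd_nontrivial : (2 <= #|rd_node|)%N;
  rd_degree : forall x, (degree rd_tree x <= 3)%N;
  rd_leaf_inj : injective rd_leaf;
  rd_leaf_onto : forall x, (x \in codom rd_leaf) = (degree rd_tree x == 1%N)
}.

Definition del_edge (V : finType) (G : sgraph V) (x y : V) : rel V :=
  [rel u v | G u v && ([set u; v]%SET != [set x; y]%SET)].

(* The vertices placed on the x-side of the tree edge xy. *)
Definition edge_side (V : finType) (D : rank_decomposition V)
    (x y : rd_node D) : {set V} :=
  [set v | connect (del_edge (rd_tree D) x y) x (rd_leaf D v)]%SET.

(* Each edge is met in both orientations; the two sides are complementary and
   have the same cut-rank. *)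
Definition rd_width (V : finType) (G : sgraph V) (D : rank_decomposition V) : nat :=
  \max_(e : rd_node D * rd_node D | rd_tree D e.1 e.2)
    cutrank G (edge_side e.1 e.2).

Definition rank_width (R : realType) (V : finType) (G : sgraph V) : \bar R :=
  if (#|V| <= 1)%N then 0%E
  else min_value R [set k | exists D : rank_decomposition V, rd_width G D = k].

(* The computational basis of m qubits is the set of bit strings of length m;
   vectors and matrices are indexed by it through [bits_index] and [index_bits]. *)
Notation bits m := {ffun 'I_m -> bool}.
Notation qdim m := #|{: {ffun 'I_m -> bool}}|.
Notation qstate C m := 'cV[C]_(qdim m).
Notation qop C m := 'M[C]_(qdim m).

Definition bits_index (m : nat) (x : bits m) : 'I_(qdim m) := enum_rank x.
Definition index_bits (m : nat) (i : 'I_(qdim m)) : bits m := enum_val i.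

Section Quantum.
Variable C : numClosedFieldType.

Definition pauliX : 'M[C]_2 := \matrix_(i, j) (i != j)%:R.
Definition pauliY : 'M[C]_2 :=
  \matrix_(i, j) if i == j then 0 else if i == 0 then - 'i else 'i.
Definition pauliZ : 'M[C]_2 :=
  \matrix_(i, j) if i == j then (-1) ^+ i else 0.

Definition tensor (m : nat) (h : 'I_m -> 'M[C]_2) : qop C m :=
  \matrix_(x, y) \prod_(k < m)
    h k (inord (index_bits x k)) (inord (index_bits y k)).

Definition pauli_group (m : nat) : set (qop C m) :=
  [set P | exists (a : C) (h : 'I_m -> 'M[C]_2),
     [/\ a \in [:: 1; -1; 'i; - 'i],
         forall k, h k \in [:: 1%:M; pauliX; pauliY; pauliZ]
       & P = a *: tensor h]].

Definition clifford (m : nat) (U : qop C m) : Prop :=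
  U \is unitarymx /\
  [set U *m P *m U ^t* | P in @pauli_group m] = @pauli_group m.

Definition restrict_bits (k m : nat) (t : k.-tuple 'I_m) (x : bits m) : bits k :=
  [ffun l => x (tnth t l)].

(* The k-qubit operator U acting on the qubits t_0, ..., t_(k-1) of an m-qubit
   register (and as the identity elsewhere); t must be duplicate-free. *)
Definition act_on (k m : nat) (t : k.-tuple 'I_m) (U : qop C k) : qop C m :=
  \matrix_(x, y)
    (U (bits_index (restrict_bits t (index_bits x)))
       (bits_index (restrict_bits t (index_bits y)))
     * [forall q : 'I_m, (q \notin t) ==> (index_bits x q == index_bits y q)]%:R).

Definition zero_state (m : nat) : qstate C m :=
  delta_mx (bits_index [ffun=> false]) 0.

Definition sq_norm (m : nat) (psi : qstate C m) : C :=
  \sum_x `|psi x 0| ^+ 2.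

Definition insert_bit (m : nat) (q : 'I_m.+1) (b : bool) (x : bits m) : bits m.+1 :=
  [ffun k => if unlift q k is Some l then x l else b].

(* The unnormalised state of the other m qubits when qubit q is measured in the
   computational basis with outcome b; they keep their relative order. *)
Definition project (m : nat) (q : 'I_m.+1) (b : bool) (psi : qstate C m.+1) :
    qstate C m :=
  \col_x psi (bits_index (insert_bit q b (index_bits x))) 0.

Definition outcome_prob (m : nat) (q : 'I_m.+1) (b : bool) (psi : qstate C m.+1) : C :=
  sq_norm (project q b psi).

(* Only meaningful if the outcome b has nonzero probability. *)
Definition post_state (m : nat) (q : 'I_m.+1) (b : bool) (psi : qstate C m.+1) :
    qstate C m :=
  (sqrtC (outcome_prob q b psi))^-1 *: project q b psi.

(* [algorithm n m]: adaptive algorithms on an m-qubit register which end with an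
   n-qubit register; the continuation of a measurement depends on its outcome. *)
Inductive algorithm (n : nat) : nat -> Type :=
| Stop : algorithm n n
| Measure (m : nat) (q : 'I_m.+1) (A : bool -> algorithm n m) : algorithm n m.+1
| Gate1 (m : nat) (q : 'I_m) (U : qop C 1) (_ : clifford U)
    (A : algorithm n m) : algorithm n m
| Gate2 (m : nat) (q q' : 'I_m) (_ : q != q') (U : qop C 2) (_ : clifford U)
    (A : algorithm n m) : algorithm n m.

(* The probability that the output state satisfies P, from the initial state psi. *)
Fixpoint output_prob (n : nat) (P : qstate C n -> Prop) (m : nat)
    (A : algorithm n m) : qstate C m -> C :=
  match A in algorithm _ m return qstate C m -> C with
  | Stop => fun psi => (`[< P psi >])%:R
  | Measure _ q A => fun psi =>
      \sum_(b : bool) outcome_prob q b psi * output_prob P (A b) (post_state q b psi)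
  | Gate1 _ q U _ A => fun psi => output_prob P A (act_on [tuple q] U *m psi)
  | Gate2 _ q q' _ U _ A => fun psi => output_prob P A (act_on [tuple q; q'] U *m psi)
  end.

(* The maximum ranges over all outcome sequences, impossible ones included; after
   an impossible outcome an algorithm may as well use no gate, so the minimum over
   algorithms is not affected. *)
Fixpoint CZ_complexity (n m : nat) (A : algorithm n m) : nat :=
  match A with
  | Stop => 0
  | Measure _ _ A => \max_(b : bool) CZ_complexity (A b)
  | Gate1 _ _ _ _ A => CZ_complexity A
  | Gate2 _ _ _ _ _ _ A => (CZ_complexity A).+1
  end.

Definition stabilizer_generator (n : nat) (G : sgraph 'I_n) (v : 'I_n) : qop C n :=
  tensor (fun w => if w == v then pauliX else if G v w then pauliZ else 1%:M).

(* [psi] represents |G>, i.e. equals it up to global phase. *)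
Definition is_graph_state (n : nat) (G : sgraph 'I_n) (psi : qstate C n) : Prop :=
  sq_norm psi = 1 /\ forall v, stabilizer_generator G v *m psi = psi.

Definition generates (n m : nat) (A : algorithm n m) (G : sgraph 'I_n) : Prop :=
  output_prob (is_graph_state G) A (zero_state m) = 1.

End Quantum.

Local Open Scope complex_scope.

Definition Gamma_CZ (R : realType) (n : nat) (G : sgraph 'I_n) : \bar R :=
  min_value R [set k | exists (s : nat) (A : algorithm R[i] n (n + s)),
                         generates A G /\ CZ_complexity A = k].

(* Main.v *)
(* Counting. Every graph whose edges join vertices at distance at most r in the order of 'I_n has
   rank-width at most r (take a caterpillar along this order), and there are at least 2^(r(n-r))
   of them. On the other hand, fix a branch of positive probability of an algorithm with at most K
   two-qubit gates. Up to scalars, its output state is determined on the qubits that met a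
   two-qubit gate by the gates, the wires they act on, and one local Clifford and one end per wire;
   only the 2K wires touched by such gates matter, and modulo scalars there are finitely many
   Clifford operators, so this leaves at most n^(aK) possibilities. The other output qubits are in
   a product state, hence isolated in the graph, so these data determine the graph, and
   2^(r(n-r)) <= n^(aK). *)

From mathcomp Require Import zify ring lra.
Require Import Defs.

Set Implicit Arguments.
Unset Strict Implicit.
Unset Printing Implicit Defensive.

(** * Rank-width of band graphs *)

Section ParentTree.
Variables (N : nat) (par : nat -> nat).
Hypothesis par_lt : forall i, 0 < i -> par i < i.

Definition par_rel : rel 'I_N :=
  fun x y => ((0 < y) && (par y == x :> nat)) || ((0 < x) && (par x == y :> nat)).

Lemma par_rel_sym : symmetric par_rel.
Proof. by move=> x y; rewrite /par_rel orbC. Qed.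

Lemma par_rel_irrefl : irreflexive par_rel.
Proof.
move=> x; rewrite /par_rel orbb; apply/negP => /andP[x0 /eqP e].
by have := par_lt x0; rewrite e ltnn.
Qed.

Definition par_graph := SGraph par_rel_sym par_rel_irrefl.

Lemma par_rel_lt x y : par_rel x y -> x < y -> par y = x.
Proof.
case/orP=> /andP[h /eqP e] xy; first by [].
by have := par_lt h; rewrite e ltnNge ltnW.
Qed.

Lemma par_rel_up (y : 'I_N) : 0 < y -> exists2 p : 'I_N, p = par y :> nat & par_rel y p.
Proof.
move=> y0; have pN : par y < N by apply: ltn_trans (par_lt y0) (ltn_ord y).
by exists (Ordinal pN) => //; rewrite /par_rel y0 /= eqxx orbT.
Qed.

Lemma par_connect (o : 'I_N) x : o = 0 :> nat -> connect par_rel o x.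
Proof.
move=> o0; have [n] := ubnP (x : nat); elim: n x => // n IH x /ltnSE xn.
have [x0|x0] := posnP x; first by rewrite (_ : o = x) ?connect0 //; apply: val_inj; rewrite /= o0.
have [p pe r] := par_rel_up x0; apply: connect_trans (IH p _) (connect1 _).
  by rewrite pe; apply: leq_trans (par_lt x0) xn.
by rewrite par_rel_sym.
Qed.

(* The two cycle neighbours of the largest vertex of a cycle would both be its parent. *)
Lemma par_tree : is_tree par_graph.
Proof.
have csym : connect_sym par_rel by apply: sym_connect_sym; exact: par_rel_sym.
split=> [x y|c sc].
  have N0 : 0 < N by apply: leq_ltn_trans (ltn_ord x).
  apply: (@connect_trans _ _ (Ordinal N0)); last exact: par_connect.
  by rewrite csym par_connect.
case/andP=> cc uc.
have [x xc xmax] : exists2 x, x \in c & forall y, y \in c -> y <= x.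
  case: c sc {cc uc} => // a c _.
  case: (arg_maxnP (fun y : 'I_N => y : nat) (mem_head a c)) => x xc h.
  by exists x.
have lt y : y \in c -> par_rel x y -> par x = y.
  move=> yc r; apply: par_rel_lt; first by rewrite par_rel_sym.
  rewrite ltn_neqAle xmax // andbT; apply: contraTneq r => e.
  by rewrite (_ : y = x) ?par_rel_irrefl //; apply: val_inj.
have nc : next c x \in c by rewrite mem_next.
have pc : prev c x \in c by rewrite mem_prev.
have e1 := lt _ nc (next_cycle cc xc).
have e2 : par x = prev c x by apply: lt pc _; rewrite par_rel_sym; exact: prev_cycle cc xc.
have e3 : next c x = prev c x by apply: val_inj; rewrite /= -e1 -e2.
have xpc : next c (next c x) = x by rewrite e3 next_prev.
case/rot_to: xc => i c' rc; move: sc xpc (uc).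
rewrite -(size_rot i) -!(next_rot i uc) -(rot_uniq i) rc.
case: c' {rc} => [|b [|d c']] //= _ + /and3P[].
rewrite !inE !negb_or eqxx => + /and3P[xb xd xc'] _ _.
rewrite (eq_sym b) (negPf xb) !eqxx => e.
by rewrite e eqxx in xd.
Qed.

(** [D] stands for the set of descendants of [i]: membership passes between a vertex and its parent,
    except across the edge above [i]. *)
Variables (i p : 'I_N) (D : pred nat).
Hypotheses (i0 : 0 < i) (pe : p = par i :> nat).
Hypothesis DE : forall y, 0 < y -> y != i -> D y = D (par y).
Hypotheses (Di : D i) (D0 : ~~ D 0).

(** The remaining edges preserve [D], and climbing to parents connects each vertex to [i] or to the
    root, according to [D]. So deleting the edge leaves exactly two components, [D] and its
    complement. *)
Lemma par_del_connect (x y : 'I_N) :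
  (x == i) || (x == p) -> connect (del_edge par_graph i p) x y = (D x == D y).
Proof.
have N0 : 0 < N by apply: leq_ltn_trans (ltn_ord x).
set e := del_edge _ _ _; set o := Ordinal N0.
have esym : symmetric e.
  by move=> u v; rewrite /e /del_edge /= par_rel_sym (finset.setUC [set u]%SET).
have csym : connect_sym e by exact: sym_connect_sym.
have D1 u v : e u v -> par v = u -> 0 < v -> D u = D v.
  case/andP=> r ne pv v0; rewrite (DE v0) ?pv //.
  apply: contraNneq ne => vi; apply/eqP.
  rewrite (_ : v = i); last exact: val_inj.
  by rewrite (_ : u = p) 1?finset.setUC //; apply: val_inj; rewrite /= pe -pv vi.
have De : {homo D \o val : u v / e u v >-> u = v}.
  move=> u v uv /=; case/andP: (uv) => /orP[]/andP[h /eqP k] _; first exact: D1.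
  by symmetry; apply: D1 => //; rewrite esym.
have Dc u v : connect e u v -> D u = D v.
  by move/connectP=> [q + ->]; elim: q u => //= w q IH u /andP[/De /= -> /IH].
have root (y1 : 'I_N) : connect e (if D y1 then i else o) y1.
  have [n] := ubnP (y1 : nat); elim: n y1 => // n IH y1 /ltnSE y1n.
  have [y0|y0] := posnP y1.
    by rewrite y0 (negPf D0) (_ : o = y1) ?connect0 //; apply: val_inj.
  have [yi|yi] := eqVneq (y1 : nat) i.
    by rewrite yi Di (_ : i = y1) ?connect0 //; apply: val_inj.
  have [q qe r] := par_rel_up y0.
  have qy : q < y1 by rewrite qe par_lt.
  have := IH q (leq_trans qy y1n); rewrite (DE y0 yi) -qe => h.
  apply: connect_trans h (connect1 _); rewrite /e /del_edge /= par_rel_sym r /=.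
  (* The climbing edge is not the deleted one: [y1] is not [i], and [y1 = p] with [q = i] would give
     [i < p < i]. *)
  apply: contraNneq yi => E.
  have : y1 \in [set i; p]%SET by rewrite -E !inE eqxx orbT.
  rewrite !inE => /orP[/eqP->//|/eqP yp].
  have : i \in [set q; y1]%SET by rewrite E !inE eqxx.
  rewrite !inE yp => /orP[/eqP iq|/eqP ->//].
  have := par_lt i0; rewrite -pe -yp => yi'.
  by move: qy; rewrite -iq => /(ltn_trans yi'); rewrite ltnn.
move=> xip; apply/idP/eqP => [|xy]; first exact: Dc.
by apply: connect_trans (root y); rewrite csym -xy root.
Qed.

End ParentTree.

(** * Upper bounds on the cut-rank *)

Section Rank.
Variables (V : finType) (G : sgraph V).

(** The cut matrix factors through dimension [r]: row [u] goes to the unit vector at [key u], and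
    row [l] of the second factor is the adjacency row of [w l]. Rows with key at least [r] are
    zero. *)
Lemma cutrank_le (S : {set V}) r (key : V -> nat) (w : nat -> V) :
  {in S, cancel key w} ->
  (forall u v, u \in S -> v \notin S -> G u v -> key u < r) ->
  cutrank G S <= r.
Proof.
move=> kw H; rewrite /cutrank.
rewrite (_ : matrix_of_fun _ _ =
    (\matrix_(i < #|S|, l < r) (key (enum_val i) == l)%:R) *m
    (\matrix_(l < r, j < #|~: S|) (G (w l) (enum_val j))%:R))%R.
  by apply: leq_trans (mxrankM_maxl _ _) (rank_leq_col _).
apply/matrixP => i j; rewrite !mxE.
have vS : enum_val j \notin S by have := enum_valP j; rewrite inE.
have [lr|rl] := ltnP (key (enum_val i)) r.
  rewrite (bigD1 (Ordinal lr)) //= !mxE eqxx mul1r kw ?enum_valP // big1 ?addr0 // => l.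
  by rewrite -val_eqE /= eq_sym => /negPf kl; rewrite !mxE kl mul0r.
rewrite big1 => [|l _]; last first.
  by rewrite !mxE gtn_eqF ?mul0r //; apply: leq_trans rl.
case e: (G _ _) => //; have := H _ _ (enum_valP i) vS e.
by rewrite ltnNge rl.
Qed.

Lemma cutrank_row (S : {set V}) : cutrank G S <= #|S|.
Proof. exact: rank_leq_row. Qed.

Lemma cutrank_col (S : {set V}) : cutrank G S <= #|~: S|.
Proof. exact: rank_leq_col. Qed.
End Rank.

(* The caterpillar: node 0, the spine 1, 3, 5, ..., and the pendant node i at i - 1 for even i. *)
Definition cpar i := (i./2).*2.-1.

Lemma cpar_lt i : 0 < i -> cpar i < i.
Proof. rewrite /cpar; lia. Qed.

Lemma cpar_adj a b : (0 < b) && (cpar b == a) || (0 < a) && (cpar a == b) ->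
  [\/ b = cpar a, b = a.+1 | b = a.+2].
Proof.
case/orP=> /andP[b0 /eqP e]; last by constructor 1.
have [bo|be] := boolP (odd b); move: e; rewrite /cpar => e.
  by have [b1|b1] := eqVneq b 1; [constructor 2 | constructor 3]; lia.
by constructor 2; lia.
Qed.

Section Caterpillar.
Variable m : nat.
Notation N := (m.+1).*2.

(** The leaves of the caterpillar are the even nodes and the far end [m.*2.+1] of the spine; the
    vertices are placed on them in increasing order along the spine. *)
Definition cleaf_val v := if v == m.+1 then m.*2.+1 else v.*2.

Lemma cleaf_lt (v : 'I_m.+2) : cleaf_val v < N.
Proof. by rewrite /cleaf_val; have := ltn_ord v; case: eqP; lia. Qed.

Definition cleaf (v : 'I_m.+2) : 'I_N := Ordinal (cleaf_lt v).

Definition ctree := par_graph N cpar_lt.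

Lemma ctreeE x y : ctree x y =
  ((0 < y) && (cpar y == x :> nat)) || ((0 < x) && (cpar x == y :> nat)).
Proof. by []. Qed.

Lemma cleaf_inj : injective cleaf.
Proof.
move=> u v /(congr1 val) /=; rewrite /cleaf_val => e; apply: val_inj => /=.
by move: e (ltn_ord u) (ltn_ord v); case: eqP; case: eqP; lia.
Qed.

Lemma ctree_degree x : degree ctree x <= 3.
Proof.
apply: (@leq_trans (size [:: inord (cpar x) : 'I_(m.*2.+1).+1; inord x.+1; inord x.+2])) => //.
apply: leq_trans (card_size _); apply/subset_leq_card/fintype.subsetP => y.
rewrite !inE ctreeE -!val_eqE /=.
have yN : y < m.*2.+2 by rewrite -doubleS ltn_ord.
by case/cpar_adj=> e; rewrite -e (inordK yN) eqxx ?orbT.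
Qed.

Lemma ctree_leaf x : (x \in codom cleaf) = (degree ctree x == 1).
Proof.
have xN := ltn_ord x; have [xl|xl] := boolP (~~ odd x || (x == m.*2.+1 :> nat)).
  transitivity true; first apply/codomP.
    have h : (if ~~ odd x then x./2 else m.+1) < m.+2 by case: ifP; lia.
    exists (Ordinal h); apply: val_inj; rewrite /= /cleaf_val.
    move: xN xl; move: (nat_of_ord x) => k kN.
    by have [ko|ke] := boolP (odd k) => /=; rewrite ?eqxx; case: eqP => /=; lia.
  (* The only neighbour of such a node is its parent or, for the root, node 1. *)
  have h : (if x == 0 :> nat then 1 else cpar x) < N.
    by rewrite /cpar; case: ifP; lia.
  rewrite /degree (fintype.eq_card1 (x := Ordinal h)) // => y.
  rewrite !inE ctreeE -val_eqE /= /cpar; move: (ltn_ord y) xN xl.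
  move: (nat_of_ord x) (nat_of_ord y) => k l lN kN kl.
  by apply/idP/idP; case: (eqVneq k 0) => k0; lia.
transitivity false.
  apply/negP => /codomP[v /(congr1 val)] /= e; move: xl.
  by rewrite e /cleaf_val; case: eqP; lia.
(* An inner spine node has at least two neighbours, its pendant node and its parent. *)
apply/esym/negbTE; rewrite neq_ltn; apply/orP; right; apply/card_gt1P.
have h : x.+1 < N by lia.
have h' : cpar x < N by rewrite /cpar; lia.
exists (Ordinal h), (Ordinal h'); rewrite !inE !ctreeE -val_eqE /= /cpar.
by split; lia.
Qed.

Definition caterpillar : rank_decomposition 'I_m.+2.
Proof.
apply: (@RankDecomposition _ _ ctree cleaf).
- exact: par_tree.
- by rewrite card_ord.
- exact: ctree_degree.
- exact: cleaf_inj.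
- exact: ctree_leaf.
Defined.

(** Cutting off a pendant node isolates one vertex, and cutting a spine edge splits the vertex order
    in two intervals. The bit [b] tells which of the two sides contains [x]. *)
Lemma edge_side_caterpillar (x y : rd_node caterpillar) :
  rd_tree caterpillar x y ->
  exists b : bool, (exists v, edge_side x y = [set u | (u == v) == b]%SET) \/
  (exists t, edge_side x y = [set u : 'I__ | (u < t) == b]%SET).
Proof.
move=> r.
(* [i] is the child end and [p] the parent end of the edge. *)
pose i : 'I_N := if x < y then y else x; pose p : 'I_N := if x < y then x else y.
have xip : (x == i) || (x == p) by rewrite /i /p; case: ifP; rewrite eqxx ?orbT.
have E : edge_side x y = [set v | connect (del_edge ctree i p) x (cleaf v)]%SET.
  apply/setP => v; rewrite !inE /=; apply: eq_connect => u w.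
  rewrite /del_edge /= (_ : [set x; y]%SET = [set i; p]%SET) //.
  by rewrite /i /p; case: ifP => // _; rewrite finset.setUC.
have [i0 pe] : 0 < i /\ p = cpar i :> nat.
  rewrite /i /p; move: r; rewrite /= /par_rel.
  by case: (ltnP x y); rewrite /cpar; lia.
clearbody i p; have [io|ie] := boolP (odd i).
  (* The descendants of a spine node [i] are all nodes [k >= i]. *)
  exists ((x < i)); right; exists (i.+1)./2; rewrite E.
  apply/setP => v; rewrite !inE.
  rewrite (@par_del_connect _ _ cpar_lt _ _ (fun k => i <= k)) //=.
  - rewrite /cleaf_val; move: (ltn_ord v) (ltn_ord i) io.
    move: (nat_of_ord i) (nat_of_ord x) (nat_of_ord v) => j k u uN jN jo.
    by apply/eqP/eqP; case: eqP; case: (ltnP k j); lia.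
  - by move=> k k0 ki; rewrite /cpar; lia.
  - lia.
(* A pendant node is its own only descendant. *)
have h : i./2 < m.+2 by have := ltn_ord i; lia.
exists (x == i); left; exists (Ordinal h); rewrite E.
apply/setP => v; rewrite !inE.
rewrite (@par_del_connect _ _ cpar_lt _ _ (fun k => k == i)) //=.
- rewrite -!val_eqE /= /cleaf_val; move: (ltn_ord v) (ltn_ord i) i0 ie.
  move: (nat_of_ord i) (nat_of_ord x) (nat_of_ord v) => j k u uN jN j0 je.
  by apply/eqP/eqP; case: (eqVneq u m.+1); case: (eqVneq k j); lia.
- by move=> k k0 ki; rewrite /cpar; lia.
- lia.
Qed.

End Caterpillar.

(** In the caterpillar, only the [r] vertices of an interval nearest to a spine cut can have
    neighbours beyond it. *)
Lemma rank_width_le (R : realType) (n r : nat) (G : sgraph 'I_n) : 1 < n ->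
  (forall u v : 'I_n, G u v -> u < v -> v <= u + r) ->
  (rank_width R G <= (r%:R)%:E)%E.
Proof.
case: n G => [|[|m]] // G _ band.
rewrite /rank_width card_ord /=.
apply: (@le_trans _ _ (((rd_width G (caterpillar m))%:R)%:E)%E).
  apply: ereal_inf_lbound; exists (rd_width G (caterpillar m)) => //.
  by exists (caterpillar m).
rewrite lee_fin ler_nat; apply/bigmax_leqP => -[x y] /= /edge_side_caterpillar.
have gtE (u v : 'I_m.+2) : G u v -> (v <= u + r) && (u <= v + r).
  move=> uv; have vu : G v u by rewrite adj_sym.
  have [h|h|h] := ltngtP u v.
  - by rewrite (band u v) // (leq_trans (ltnW h)) ?leq_addr.
  - by rewrite (band v u) // andbT (leq_trans (ltnW h)) ?leq_addr.
  - by rewrite h leq_addr.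
case=> b [[v ->]|[t ->]]; last first.
  (* [key] is the distance to the cut, counted from 0 on either side, and [w] is its inverse on the
     chosen side. *)
  pose key (u : 'I_m.+2) := if u < t then t - u.+1 else u - t.
  pose w k : 'I_m.+2 := inord (if b then t - k.+1 else t + k).
  apply: (@cutrank_le _ _ _ _ key w) => [u|u v].
    rewrite inE /w /key => /eqP <-; rewrite -[RHS]inord_val.
    by congr inord; case: ltnP; lia.
  rewrite !inE => /eqP <- vt /gtE; rewrite /key.
  by move: vt; case: (ltnP u t); case: (ltnP v t) => //; lia.
(* For [r = 0] there are no edges and every cut has rank 0; otherwise the side that is a singleton
   bounds the rank by 1. *)
have [r0|r0] := posnP r.
  apply: (@cutrank_le _ _ _ r (@nat_of_ord _) inord) => [u _|u z _ _ uz].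
    exact: inord_val.
  have := gtE _ _ uz; rewrite r0 !addn0 -eqn_leq => /eqP zu.
  by move: uz; rewrite (_ : z = u) ?adj_irrefl //; apply: val_inj.
apply: leq_trans r0; case: b.
  apply: leq_trans (cutrank_row _ _) _.
  by rewrite (_ : finset _ = [set v]%SET) ?cards1 //; apply/setP => u; rewrite !inE eqb_id.
apply: leq_trans (cutrank_col _ _) _.
rewrite (_ : ~: _ = [set v])%SET ?cards1 //; apply/setP => u.
by rewrite !inE eqbF_neg negbK.
Qed.

(** * A large family of graphs of bandwidth at most [r] *)

Section Family.
Variables (n r : nat).
Variable f : {ffun 'I_(n - r) * 'I_r -> bool}.

(** The bit at [(i, d)] decides the edge between [i] and [i + d + 1]. The ranges [i < n - r] and
    [d < r] keep both ends below [n], so all bits are free. *)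
Definition band_half (u v : 'I_n) :=
  [exists p, f p && (u == p.1 :> nat) && (v == p.1 + p.2.+1 :> nat)].

Lemma band_halfP (u v : 'I_n) : band_half u v -> u < v <= u + r.
Proof.
case/existsP => -[i d] /= /andP[/andP[_ /eqP ->] /eqP ->].
by rewrite addnS ltnS leq_addr -addnS leq_add2l ltn_ord.
Qed.

Definition band_rel : rel 'I_n := fun u v => band_half u v || band_half v u.

Lemma band_rel_sym : symmetric band_rel.
Proof. by move=> u v; rewrite /band_rel orbC. Qed.

Lemma band_rel_irrefl : irreflexive band_rel.
Proof.
by move=> u; rewrite /band_rel orbb; case h: (band_half u u) => //; have := band_halfP h; rewrite ltnn.
Qed.

Definition band_graph := SGraph band_rel_sym band_rel_irrefl.

Lemma band_graph_width (u v : 'I_n) : band_graph u v -> u < v -> v <= u + r.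
Proof.
by case/orP=> /band_halfP /andP[uv h] vu; last by move: uv; rewrite ltnNge ltnW.
Qed.

Lemma band_graphE (p : 'I_(n - r) * 'I_r) (u v : 'I_n) :
  u = p.1 :> nat -> v = p.1 + p.2.+1 :> nat -> band_graph u v = f p.
Proof.
case: p => i d /= ui vd; rewrite /band_rel.
have -> : band_half v u = false.
  by case h: (band_half v u) => //; have := band_halfP h; rewrite ui vd; lia.
rewrite orbF; apply/existsP/idP => [[[i' d'] /=]|fp]; last first.
  by exists (i, d); rewrite fp ui vd /= !eqxx.
rewrite ui vd -andbA => /and3P[+ /eqP ii' /eqP].
have -> : i' = i by apply: val_inj.
by move=> fp /addnI [dd']; rewrite (_ : d = d') //; apply: val_inj.
Qed.

End Family.

Lemma band_graph_inj n r (f g : {ffun 'I_(n - r) * 'I_r -> bool}) :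
  band_graph f =2 band_graph g -> f = g.
Proof.
move=> H; apply/ffunP => p.
have un : p.1 < n by apply: leq_trans (ltn_ord _) (leq_subr _ _).
have vn : p.1 + p.2.+1 < n.
  by have := ltn_ord p.1; have := ltn_ord p.2; lia.
by rewrite -!(@band_graphE _ _ _ p (Ordinal un) (Ordinal vn)) // H.
Qed.

(** * Clifford operators up to scalars *)

Local Open Scope ring_scope.
Local Open Scope sesquilinear_scope.

Definition xor_bits m (s x : bits m) : bits m := [ffun k => x k (+) s k].

Lemma xor_bitsK m (s : bits m) : involutive (xor_bits s).
Proof. by move=> x; apply/ffunP => k; rewrite !ffunE -addbA addbb addbF. Qed.

(** * Multiplication by tensor products of monomial matrices *)

Section Tensor.
Variables (C : numClosedFieldType) (m : nat).

Lemma bits_indexK : cancel (@bits_index m) (@index_bits m).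
Proof. exact: enum_rankK. Qed.

Lemma index_bitsK : cancel (@index_bits m) (@bits_index m).
Proof. exact: enum_valK. Qed.

(** Factor [k] flips its bit exactly if [s k] holds, and [p k a] is its entry in row [a]; the Pauli
    matrices have this shape. *)
Definition monomial (h : 'I_m -> 'M[C]_2) (s : bits m) (p : 'I_m -> bool -> C) :=
  forall k (a b : bool), h k (inord a) (inord b) = (b == a (+) s k)%:R * p k a.

Variables (h : 'I_m -> 'M[C]_2) (s : bits m) (p : 'I_m -> bool -> C).
Hypothesis hsp : monomial h s p.

Lemma tensor_monomial x y : tensor h x y =
  (index_bits y == xor_bits s (index_bits x))%:R * \prod_k p k (index_bits x k).
Proof.
rewrite mxE (eq_bigr _ (fun k _ => hsp k _ _)) big_split /=; congr (_ * _).
have [/eqP e|/eqP/ffunP ne] := boolP (_ == _).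
  by rewrite big1 // => k _; rewrite e ffunE eqxx.
have [k yk] : exists k, index_bits y k != index_bits x k (+) s k.
  apply: contrapT => H; apply: ne => k; rewrite ffunE; apply/eqP.
  by apply: contrapT => /negP hk; apply: H; exists k.
by rewrite (bigD1 k) //= (negPf yk) mul0r.
Qed.

Lemma tensor_mul q (M : 'M[C]_(_, q)) i j : (tensor h *m M) i j =
  (\prod_k p k (index_bits i k)) * M (bits_index (xor_bits s (index_bits i))) j.
Proof.
rewrite mxE (bigD1 (bits_index (xor_bits s (index_bits i)))) //= big1 ?addr0 => [|l li].
  by rewrite tensor_monomial bits_indexK eqxx mul1r.
rewrite tensor_monomial (_ : (_ == _) = false) ?mul0r //.
by apply: contraNF li => /eqP <-; rewrite index_bitsK.
Qed.

Lemma mul_tensor q (M : 'M[C]_(q, _)) i j : (M *m tensor h) i j =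
  M i (bits_index (xor_bits s (index_bits j))) *
  \prod_k p k (index_bits j k (+) s k).
Proof.
rewrite mxE (bigD1 (bits_index (xor_bits s (index_bits j)))) //= big1 ?addr0 => [|l li].
  rewrite tensor_monomial bits_indexK xor_bitsK eqxx mul1r; congr (_ * _).
  by apply: eq_bigr => k _; rewrite ffunE.
rewrite tensor_monomial (_ : (_ == _) = false) ?mul0r ?mulr0 //.
by apply: contraNF li => /eqP ->; rewrite xor_bitsK index_bitsK.
Qed.

End Tensor.

Section PauliEntries.
Variable C : numClosedFieldType.

Lemma inord2_eq (a b : bool) : (inord a == inord b :> 'I_2) = (a == b).
Proof. by rewrite -val_eqE /= !inordK; case: a; case: b. Qed.

Lemma pauli1E (a b : bool) : (1%:M : 'M[C]_2) (inord a) (inord b) = (b == a)%:R.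
Proof. by rewrite mxE inord2_eq eq_sym. Qed.

Lemma pauliXE (a b : bool) : pauliX C (inord a) (inord b) = (b == ~~ a)%:R.
Proof. by rewrite mxE inord2_eq; case: a; case: b. Qed.

Lemma pauliZE (a b : bool) : pauliZ C (inord a) (inord b) = (b == a)%:R * (-1) ^+ a.
Proof.
rewrite mxE inord2_eq inordK; last by case: a.
by case: a; case: b; rewrite ?mul1r ?mul0r.
Qed.

End PauliEntries.

(** * Finiteness of the Clifford group modulo scalars *)

Section CliffordFinite.
Variables (C : numClosedFieldType) (m : nat).

(** A product of [X] along the ones of [i] carries the diagonal entry at [i] to the one at 0. If [i]
    and [j] differ at qubit [k], commuting with [Z] there gives [W i j = - W i j]. *)
Lemma commute_pauli_scalar (W : qop C m) :
  (forall h : 'I_m -> 'M[C]_2,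
     (forall k, h k \in [:: 1%:M; pauliX C; pauliY C; pauliZ C]) ->
     W *m tensor h = tensor h *m W) ->
  exists a : C, W = a%:M.
Proof.
move=> H; pose o : bits m := [ffun=> false].
exists (W (bits_index o) (bits_index o)); apply/matrixP => i j.
rewrite [RHS]mxE; have [<-|ij] := eqVneq i j.
  pose s := index_bits i.
  pose h k := if s k then pauliX C else 1%:M.
  have hs : monomial h s (fun _ _ => 1).
    move=> k a b; rewrite /h mulr1; case: (s k); first by rewrite pauliXE addbT.
    by rewrite pauli1E addbF.
  have /(_ _)/matrixP/(_ (bits_index o) i) := H h.
  rewrite (mul_tensor hs) (tensor_mul hs) !big1 // mulr1 mul1r !bits_indexK -/s.
  have -> : xor_bits s s = o by apply/ffunP => k; rewrite !ffunE addbb.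
  have -> : xor_bits s o = s by apply/ffunP => k; rewrite !ffunE.
  rewrite index_bitsK => -> //.
  by move=> k; rewrite /h; case: (s k); rewrite !inE eqxx ?orbT.
have [k ijk] : exists k, index_bits i k != index_bits j k.
  apply: contrapT => E; move/negP: ij; apply; apply/eqP.
  rewrite -(index_bitsK i) -(index_bitsK j); congr bits_index; apply/ffunP => k.
  by apply/eqP; apply: contrapT => /negP hk; apply: E; exists k.
pose h l := if l == k then pauliZ C else 1%:M.
pose p l (a : bool) : C := if l == k then (-1) ^+ a else 1.
have hs : monomial h o p.
  move=> l a b; rewrite /h /p ffunE addbF; case: eqP => _; first by rewrite pauliZE.
  by rewrite pauli1E mulr1.
have /(_ _)/matrixP/(_ i j) := H h.
have pE x : \prod_l p l (x l) = (-1) ^+ (x k).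
  by rewrite (bigD1 k) //= big1 /p ?eqxx ?mulr1 // => l /negPf->.
have oE x : xor_bits o x = x by apply/ffunP => l; rewrite !ffunE addbF.
rewrite (mul_tensor hs) (tensor_mul hs) !oE !index_bitsK.
have -> : \prod_l p l (index_bits j l (+) o l) = (-1) ^+ (index_bits j k).
  by rewrite -pE; apply: eq_bigr => l _; rewrite ffunE addbF.
rewrite pE => E; apply/eqP; rewrite mulr0n.
have {}E : W i j * (-1) ^+ index_bits j k = (-1) ^+ index_bits i k * W i j.
  by apply: E => l; rewrite /h; case: (l == k); rewrite !inE eqxx ?orbT.
have : W i j *+ 2 = 0.
  move: ijk E; case: (index_bits i k); case: (index_bits j k) => //= _.
    by rewrite !expr1 expr0 mulr1 mulN1r mulr2n => {1}->; rewrite addNr.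
  by rewrite !expr1 expr0 mul1r mulrN1 mulr2n => {1}<-; rewrite addNr.
by move/eqP; rewrite mulrn_eq0.
Qed.

Lemma clifford1 : clifford (1%:M : qop C m).
Proof.
have E : (1%:M : qop C m) ^t* = 1%:M by rewrite trmx1 map_mx1.
split; first by apply/unitarymxP; rewrite E mulmx1.
by apply/seteqP; split=> [P [Q hQ <-]|P hP]; [|exists P => //]; rewrite E mulmx1 mul1mx.
Qed.

Lemma clifford_mul (U V : qop C m) : clifford U -> clifford V -> clifford (U *m V).
Proof.
move=> [uU gU] [uV gV]; split; first exact: mul_unitarymx.
have E P : U *m V *m P *m (U *m V) ^t* = U *m (V *m P *m V ^t*) *m U ^t*.
  by rewrite trmx_mul map_mxM !mulmxA.
apply/seteqP; split=> [P [Q hQ <-]|P].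
  rewrite E -gU; exists (V *m Q *m V ^t*) => //.
  by rewrite -gV; exists Q.
rewrite -{1}gU => -[Q + <-]; rewrite -{1}gV => -[Q' hQ' <-].
by exists Q'.
Qed.

(** The adjoint of [V] times [U] commutes with every Pauli tensor, hence is a scalar. *)
Lemma clifford_eq_scale (U V : qop C m) : clifford U -> clifford V ->
  (forall h : 'I_m -> 'M[C]_2,
     (forall k, h k \in [:: 1%:M; pauliX C; pauliY C; pauliZ C]) ->
     U *m tensor h *m U ^t* = V *m tensor h *m V ^t*) ->
  exists a : C, U = a *: V.
Proof.
move=> [uU _] [uV _] H.
have VV : V ^t* *m V = 1%:M by apply: mulmx1C; apply/unitarymxP.
have [|a Wa] := @commute_pauli_scalar (V ^t* *m U).
  move=> h hh; have := congr1 (mulmx (V ^t*)) (congr1 (mulmxr U) (H h hh)).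
  rewrite /mulmxr (mulmxKtV _ uU) // !mulmxA => ->.
  by rewrite VV mul1mx.
exists a; rewrite -mul_mx_scalar -Wa mulmxA.
by rewrite (unitarymxP uV) mul1mx.
Qed.

Definition pauli_mx (k : {ffun 'I_m -> 'I_4}) : qop C m :=
  tensor (fun l => nth 1%:M [:: 1%:M; pauliX C; pauliY C; pauliZ C] (k l)).

Lemma pauli_mxP (h : 'I_m -> 'M[C]_2) :
  (forall k, h k \in [:: 1%:M; pauliX C; pauliY C; pauliZ C]) ->
  exists k, tensor h = pauli_mx k.
Proof.
move=> H; pose s := [:: 1%:M; pauliX C; pauliY C; pauliZ C].
exists [ffun l => inord (index (h l) s)]; rewrite /pauli_mx; congr tensor.
apply: funext => l; rewrite ffunE inordK ?nth_index //.
by rewrite -[4%N]/(size s) index_mem.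
Qed.

(** Up to a scalar, a Clifford operator is determined by its conjugation action on Pauli tensors, a
    function between finite sets. The extra index [None] makes the identity itself a representative,
    with no scalar. *)
Lemma clifford_finite : exists (F : finType) (rep : F -> qop C m) (i : F),
  [/\ forall c, clifford (rep c), rep i = 1%:M
    & forall U, clifford U -> exists c a, U = a *: rep c].
Proof.
pose B := {ffun 'I_m -> 'I_4}.
pose im (c : 'I_4 * B) := [:: 1; -1; 'i; - 'i]`_(c.1) *: pauli_mx c.2.
pose has (f : {ffun B -> 'I_4 * B}) U :=
  clifford U /\ forall k, U *m pauli_mx k *m U ^t* = im (f k).
(* A function that no Clifford operator induces gets the default [1%:M], which is Clifford too. *)
pose rep c := if c is Some f then xget 1%:M [set U | has f U] else 1%:M.
exists (option {ffun B -> 'I_4 * B}), rep, None; split=> //.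
  case=> [f|]; last exact: clifford1.
  by rewrite /rep; case: xgetP => [U _ []//|_]; exact: clifford1.
move=> U cU; have [uU gU] := cU.
have /choice[f hf] : forall k, exists c, U *m pauli_mx k *m U ^t* = im c.
  move=> k; have : pauli_group (U *m pauli_mx k *m U ^t*).
    rewrite -gU; exists (pauli_mx k) => //; exists 1.
    exists (fun l => nth 1%:M [:: 1%:M; pauliX C; pauliY C; pauliZ C] (k l)).
    by rewrite scale1r; split=> [|l|//]; [rewrite inE eqxx | apply: mem_nth; apply: ltn_ord].
  case=> a [h [ha /pauli_mxP[k' ->] ->]].
  have ia : (index a [:: 1; -1; 'i; - 'i]%R < 4)%N.
    by rewrite -[4%N]/(size [:: (1 : C); -1; 'i; - 'i]) index_mem.
  by exists (Ordinal ia, k'); rewrite /im /= nth_index.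
exists (Some (finfun f)); rewrite /rep; case: xgetP => [V _ [cV hV]|/(_ U)[]]; last first.
  by split=> // k; rewrite ffunE.
apply: clifford_eq_scale => // h /pauli_mxP[k ->].
by rewrite hf hV ffunE.
Qed.

End CliffordFinite.

(** * Amplitudes *)

Lemma ord2_cases (i : 'I_2) : i = 0 \/ i = 1.
Proof. by case: i => [[|[|//]]] ?; [left | right]; apply: val_inj. Qed.

Section Amplitudes.
Variables (C : numClosedFieldType) (m : nat).

Definition amp (psi : qstate C m) (x : bits m) : C := psi (bits_index x) 0.

Definition set_bit (x : bits m) (q : 'I_m) (b : bool) : bits m :=
  [ffun k => if k == q then b else x k].

Definition bits1 (a : bool) : bits 1 := [ffun=> a].
Definition bits2 (a b : bool) : bits 2 := [ffun l => if l == 0 then a else b].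

Definition entry1 (U : qop C 1) a b := U (bits_index (bits1 a)) (bits_index (bits1 b)).
Definition entry2 (U : qop C 2) a b c d :=
  U (bits_index (bits2 a b)) (bits_index (bits2 c d)).

(** By hypothesis [o z] is the only string that agrees with [x] off [t] and restricts to [z] on [t],
    so these are the only terms of the matrix product that survive. *)
Lemma amp_act k (t : k.-tuple 'I_m) (U : qop C k) (psi : qstate C m) (x : bits m)
    (o : bits k -> bits m) :
  (forall (y : bits m) z, [forall q, (q \notin t) ==> (x q == y q)] &&
                          (restrict_bits t y == z) = (y == o z)) ->
  amp (act_on t U *m psi) x =
  \sum_z U (bits_index (restrict_bits t x)) (bits_index z) * amp psi (o z).
Proof.
move=> ho; rewrite /amp mxE (reindex (@bits_index m)) /=; last first.
  by apply: onW_bij; exists (@index_bits m); [exact: bits_indexK | exact: index_bitsK].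
rewrite (partition_big (restrict_bits t) xpredT) //=; apply: eq_bigr => z _.
rewrite big_mkcond (bigD1 (o z)) //= big1 ?addr0 => [|y yz].
  have := ho (o z) z; rewrite eqxx => /andP[h1 h2].
  by rewrite h2 mxE !bits_indexK h1 mulr1 (eqP h2).
have := ho y z; rewrite (negPf yz) mxE !bits_indexK.
by case: ifP => //; rewrite andbT => _ ->; rewrite mulr0 mul0r.
Qed.

Lemma sum_bits1 (f : bits 1 -> C) : \sum_z f z = \sum_b f (bits1 b).
Proof.
rewrite (reindex bits1) //=; apply: onW_bij; exists (fun z : bits 1 => z 0) => [b|z].
  by rewrite ffunE.
by apply/ffunP => i; rewrite ffunE ord1.
Qed.

Lemma sum_bits2 (f : bits 2 -> C) : \sum_z f z = \sum_a \sum_b f (bits2 a b).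
Proof.
rewrite pair_bigA (reindex (fun p : bool * bool => bits2 p.1 p.2)) //=.
apply: onW_bij; exists (fun z : bits 2 => (z 0, z 1)) => [[a b]|z]; first by rewrite /= !ffunE.
by apply/ffunP => i; rewrite ffunE; case: (ord2_cases i) => ->.
Qed.

Lemma amp_act1 (q : 'I_m) (U : qop C 1) psi x :
  amp (act_on [tuple q] U *m psi) x = \sum_b entry1 U (x q) b * amp psi (set_bit x q b).
Proof.
rewrite (@amp_act _ _ _ _ _ (fun z : bits 1 => set_bit x q (z 0))) => [|y z].
  rewrite sum_bits1; apply: eq_bigr => b _; rewrite ffunE; congr (U (bits_index _) _ * _).
  by apply/ffunP => i; rewrite !ffunE ord1.
apply/andP/eqP => [[/forallP h /eqP <-]|->].
  apply/ffunP => k; rewrite !ffunE; case: eqP => [->//|/eqP kq].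
  by have := h k; rewrite inE kq /= => /eqP.
split; first by apply/forallP => k; rewrite inE ffunE; case: eqP => //= _; rewrite eqxx.
by apply/eqP/ffunP => i; rewrite !ffunE !ord1 (_ : tnth _ _ = q) ?eqxx.
Qed.

Lemma amp_act2 (q q' : 'I_m) (U : qop C 2) psi x : q != q' ->
  amp (act_on [tuple q; q'] U *m psi) x =
  \sum_c \sum_d entry2 U (x q) (x q') c d * amp psi (set_bit (set_bit x q c) q' d).
Proof.
move=> qq'.
rewrite (@amp_act _ _ _ _ _ (fun z : bits 2 => set_bit (set_bit x q (z 0)) q' (z 1))) => [|y z].
  rewrite sum_bits2; apply: eq_bigr => c _; apply: eq_bigr => d _; rewrite !ffunE /=.
  congr (U (bits_index _) _ * _).
  by apply/ffunP => i; rewrite !ffunE; case: (ord2_cases i) => ->.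
apply/andP/eqP => [[/forallP h /eqP <-]|->].
  apply/ffunP => k; rewrite !ffunE; case: eqP => [->//|/eqP kq'].
  case: eqP => [->//|/eqP kq].
  by have := h k; rewrite !inE (negPf kq) (negPf kq') /= => /eqP.
split.
  apply/forallP => k; rewrite !inE !ffunE negb_or.
  by case: eqP => //= _; case: eqP => //= _; rewrite eqxx.
apply/eqP/ffunP => i; rewrite !ffunE; case: (ord2_cases i) => ->.
  by rewrite (_ : tnth _ _ = q) // (negPf qq') eqxx.
by rewrite (_ : tnth _ _ = q') // eqxx.
Qed.

Lemma amp_scale a psi x : amp (a *: psi) x = a * amp psi x.
Proof. by rewrite /amp mxE. Qed.

End Amplitudes.

Lemma amp_project (C : numClosedFieldType) m (q : 'I_m.+1) b (psi : qstate C m.+1) x :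
  amp (project q b psi) x = amp psi (insert_bit q b x).
Proof. by rewrite /amp mxE bits_indexK. Qed.

Lemma amp_zero_state (C : numClosedFieldType) m (x : bits m) :
  amp (zero_state C m) x = \prod_q (x q == false)%:R.
Proof.
rewrite /amp mxE andbT (inj_eq (can_inj (@bits_indexK m))).
have [->|/eqP/ffunP xn] := eqVneq; first by rewrite big1 // => q _; rewrite ffunE eqxx.
have [q xq] : exists q, x q != false.
  apply: contrapT => H; apply: xn => q; rewrite ffunE; apply/eqP.
  by apply: contrapT => /negP h; apply: H; exists q.
by rewrite (bigD1 q) //= (negPf xq) mul0r.
Qed.

Lemma entry1_mul (C : numClosedFieldType) (U V : qop C 1) a c :
  entry1 (U *m V) a c = \sum_b entry1 U a b * entry1 V b c.
Proof.
rewrite /entry1 mxE (reindex (@bits_index 1)) /= ?sum_bits1 //.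
by apply: onW_bij; exists (@index_bits 1); [exact: bits_indexK | exact: index_bitsK].
Qed.

Lemma entry1_1 (C : numClosedFieldType) a b : entry1 (1%:M : qop C 1) a b = (b == a)%:R.
Proof.
rewrite /entry1 mxE (inj_eq (can_inj (@bits_indexK 1))) eq_sym; congr (_%:R).
by congr nat_of_bool; apply/eqP/eqP => [/ffunP/(_ 0)|->//]; rewrite !ffunE.
Qed.

(** * Normal form of the reachable states *)

Definition upd (I : eqType) (T : Type) (v : I -> T) (i : I) (u : T) : I -> T :=
  fun j => if j == i then u else v j.

Lemma upd_same (I : eqType) (T : Type) (v : I -> T) i u : upd v i u i = u.
Proof. by rewrite /upd eqxx. Qed.

Lemma upd_other (I : eqType) (T : Type) (v : I -> T) i u j : j != i -> upd v i u j = v j.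
Proof. by rewrite /upd => /negPf->. Qed.

Lemma upd_upd (I : eqType) (T : Type) (v : I -> T) i u u' :
  upd (upd v i u) i u' = upd v i u'.
Proof. by apply: funext => j; rewrite /upd; case: eqP. Qed.

Lemma upd_comm (I : eqType) (T : Type) (v : I -> T) i j u u' : i != j ->
  upd (upd v i u) j u' = upd (upd v j u') i u.
Proof.
move=> ij; apply: funext => k; rewrite /upd.
by case: (eqVneq k j) => [->|//]; rewrite eq_sym (negPf ij).
Qed.

Section NormalForm.
Variable C : numClosedFieldType.
Variables (F1 F2 : finType) (rep1 : F1 -> qop C 1) (rep2 : F2 -> qop C 2) (one : F1).
Hypothesis rep1_clifford : forall c, clifford (rep1 c).
Hypothesis rep1_one : rep1 one = 1%:M.
Hypothesis rep1P : forall U, clifford U -> exists c a, U = a *: rep1 c.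
Hypothesis rep2P : forall U, clifford U -> exists c a, U = a *: rep2 c.
Variable N : nat.

(* A state on N wires is represented by its contractions with products of one covector per wire. *)
Notation covectors := ('I_N -> bool -> C).
Notation gate := ('I_N * 'I_N * F2 * (F1 * F1))%type.

(** The contraction of the all-zero state. *)
Definition zero_wires (v : covectors) : C := \prod_w v w false.

(** The local Cliffords [l0] and [l1] act first, then [u]. The covectors are pulled back through
    [u], expanded in the basis, and each basis covector becomes a row of the local Clifford. *)
Definition apply_gate (g : gate) (T : covectors -> C) (v : covectors) : C :=
  let: (w0, w1, u, (l0, l1)) := g in
  \sum_a \sum_b \sum_c \sum_d v w0 a * v w1 b * entry2 (rep2 u) a b c d *
    T (upd (upd v w0 (entry1 (rep1 l0) c)) w1 (entry1 (rep1 l1) d)).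

(** The head of the list is the last gate. [None] does nothing; it pads lists to a common length for
    counting. *)
Definition contract (gs : seq (option gate)) : covectors -> C :=
  foldr (fun g T => if g is Some g then apply_gate g T else T) zero_wires gs.

Definition multilinear (T : covectors -> C) :=
  forall v w (a : bool -> C) (u : bool -> bool -> C),
  T (upd v w (fun c => \sum_b a b * u b c)) = \sum_b a b * T (upd v w (u b)).

(** Wire [w] is still unentangled in the zero state, so its covector only enters through its value
    at [false]. *)
Definition zero_at (T : covectors -> C) w :=
  forall v u, T (upd v w u) = u false * T (upd v w (fun c => (c == false)%:R)).

Lemma multilinearZ T v w a u : multilinear T ->
  T (upd v w (fun c => a * u c)) = a * T (upd v w u).
Proof.
move=> mT; have := mT v w (fun b => if b then a else 0) (fun=> u).
rewrite big_bool /= mul0r addr0 => <-; congr (T (upd _ _ _)); apply: funext => c.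
by rewrite big_bool /= mul0r addr0.
Qed.

Lemma zero_wires_upd v w u :
  zero_wires (upd v w u) = u false * \prod_(w' | w' != w) v w' false.
Proof.
rewrite /zero_wires (bigD1 w) //= upd_same; congr (_ * _).
by apply: eq_bigr => w' h; rewrite upd_other.
Qed.

Lemma zero_wires_multilinear : multilinear zero_wires.
Proof.
move=> v w a u; rewrite zero_wires_upd mulr_suml.
by apply: eq_bigr => b _; rewrite zero_wires_upd mulrA.
Qed.

Lemma zero_wires_zero_at w : zero_at zero_wires w.
Proof. by move=> v u; rewrite !zero_wires_upd eqxx mul1r. Qed.

Lemma apply_gate_multilinear w0 w1 u l T : w0 != w1 -> multilinear T ->
  multilinear (apply_gate (w0, w1, u, l) T).
Proof.
case: l => l0 l1 w01 mT v w a x; rewrite /apply_gate.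
have w10 : w1 != w0 by rewrite eq_sym.
have [->|ww0] := eqVneq w w0.
  rewrite !big_bool !upd_upd !upd_same !(upd_other _ _ w10) /= !big_bool /=; ring.
have [->|ww1] := eqVneq w w1.
  rewrite !big_bool !upd_same !(upd_other _ _ w01) !(upd_comm _ _ _ w10) !upd_upd /= !big_bool /=.
  ring.
have w0w : w0 != w by rewrite eq_sym.
have w1w : w1 != w by rewrite eq_sym.
rewrite !big_bool !(upd_other _ _ w0w) !(upd_other _ _ w1w).
rewrite !(upd_comm _ _ _ ww0) !(upd_comm _ _ _ ww1) !mT /= !big_bool /=.
ring.
Qed.

Lemma apply_gate_zero_at w0 w1 u l T w : w != w0 -> w != w1 -> zero_at T w ->
  zero_at (apply_gate (w0, w1, u, l) T) w.
Proof.
case: l => l0 l1 ww0 ww1 zT v x; rewrite /apply_gate.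
have w0w : w0 != w by rewrite eq_sym.
have w1w : w1 != w by rewrite eq_sym.
do 4! (rewrite mulr_sumr; apply: eq_bigr => ? _).
rewrite !(upd_other _ _ w0w) !(upd_other _ _ w1w).
rewrite !(upd_comm _ _ _ ww0) !(upd_comm _ _ _ ww1) zT; ring.
Qed.

Lemma inr_eq (T T' : eqType) (x y : T') : (inr T x == inr T y) = (x == y).
Proof. by apply/eqP/eqP => [[]|->]. Qed.

Definition out_bit m (o : bool + 'I_m) (x : bits m) : bool :=
  match o with inl b => b | inr q => x q end.

(** The covectors whose contraction gives the amplitude at [x]: the basis covector of the final bit
    of each wire, pulled back through the pending local Clifford. *)
Definition out_covectors m (L : 'I_N -> F1) (out : 'I_N -> bool + 'I_m) (x : bits m) : covectors :=
  fun w => entry1 (rep1 (L w)) (out_bit (out w) x).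

Definition live m (out : 'I_N -> bool + 'I_m) q := [exists w, out w == inr q].

(** A qubit without a wire is in the product state obtained from zero by its local Clifford. *)
Definition idle_factor m (out : 'I_N -> bool + 'I_m) (l : 'I_m -> F1) (x : bits m) q : C :=
  if live out q then 1 else entry1 (rep1 (l q)) (x q) false.

(* Every qubit of psi either is the end of a wire or has not met a two-qubit gate; wires that end
   in a bit were measured with that outcome. Wires t, t + 1, ... are fresh, at most k two-qubit
   gates were applied, and the qubits in A sit on wires. *)
Inductive normal_form m (t k : nat) (A : seq 'I_m) (psi : qstate C m) : Prop :=
  NormalForm gs (out : 'I_N -> bool + 'I_m) L l lam of
    (size gs <= k)%N & multilinear (contract gs) &
    (forall w : 'I_N, (t <= w)%N ->
      [/\ zero_at (contract gs) w, out w = inl false & L w = one]) &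
    (forall w w' q, out w = inr q -> out w' = inr q -> w = w') &
    {in A, forall q, live out q} &
    (forall x, amp psi x = lam * contract gs (out_covectors L out x) *
                           \prod_q idle_factor out l x q).

Lemma live_out m (out : 'I_N -> bool + 'I_m) q : live out q -> exists w, out w = inr q.
Proof. by case/existsP => w /eqP; exists w. Qed.

Lemma normal_form_weaken m t t' k k' A A' (psi : qstate C m) :
  (t <= t')%N -> (k <= k')%N -> {subset A' <= A} ->
  normal_form t k A psi -> normal_form t' k' A' psi.
Proof.
move=> tt kk AA [gs out L l lam gsk mT fr inj lv E].
apply: (NormalForm (leq_trans gsk kk) mT _ inj _ E) => [w tw|q /AA]; last exact: lv.
by apply: fr; apply: leq_trans tw.
Qed.

(** All qubits are idle and all wires fresh; a fresh wire contributes the factor 1. *)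
Lemma normal_form_zero m : normal_form 0 0 [::] (zero_state C m).
Proof.
apply: (@NormalForm _ _ _ _ _ [::] (fun=> inl false) (fun=> one) (fun=> one) 1) => //.
- exact: zero_wires_multilinear.
- by move=> w _; split=> //; apply: zero_wires_zero_at.
move=> x; rewrite amp_zero_state mul1r /= /zero_wires [X in _ = X * _]big1 ?mul1r => [|w _]; last first.
  by rewrite /out_covectors /= rep1_one entry1_1 eqxx.
apply: eq_bigr => q _; rewrite /idle_factor (_ : live _ _ = false) ?rep1_one ?entry1_1 1?eq_sym //.
by apply/existsP => -[].
Qed.

Lemma normal_form_scale m t k A a (psi : qstate C m) :
  normal_form t k A psi -> normal_form t k A (a *: psi).
Proof.
move=> [gs out L l lam gsk mT fr inj lv E].
apply: (@NormalForm _ _ _ _ _ gs out L l (a * lam)) => // x.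
by rewrite amp_scale E !mulrA.
Qed.

Lemma out_covectors_set m L (out : 'I_N -> bool + 'I_m) x w q b :
  (forall w w' q, out w = inr q -> out w' = inr q -> w = w') -> out w = inr q ->
  out_covectors L out (set_bit x q b) = upd (out_covectors L out x) w (entry1 (rep1 (L w)) b).
Proof.
move=> inj wq; apply: funext => w'; rewrite /upd /out_covectors.
case: eqP => [->|w'w]; first by rewrite wq /= ffunE eqxx.
case e: (out w') => [//|q'] /=; rewrite ffunE; case: eqP => // qq'.
by case: w'w; apply: inj wq; rewrite e qq'.
Qed.

Lemma out_covectors_ext m L (out : 'I_N -> bool + 'I_m) (x y : bits m) :
  (forall q, live out q -> x q = y q) -> out_covectors L out x = out_covectors L out y.
Proof.
move=> xy; apply: funext => w; rewrite /out_covectors; case e: (out w) => [//|q] /=.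
by rewrite xy //; apply/existsP; exists w; rewrite e.
Qed.

Lemma idle_factor_set m (out : 'I_N -> bool + 'I_m) l x q b q' : live out q ->
  idle_factor out l (set_bit x q b) q' = idle_factor out l x q'.
Proof.
rewrite /idle_factor ffunE => lq; case: ifP => // lq'.
by case: eqP => // qq'; rewrite qq' lq in lq'.
Qed.

(** The gate is merged into the pending local Clifford of the wire or of the idle qubit, and the
    scalar from choosing a representative goes into [lam]. *)
Lemma normal_form_gate1 m t k (q : 'I_m) U (psi : qstate C m) : clifford U ->
  normal_form t k [::] psi -> normal_form t k [::] (act_on [tuple q] U *m psi).
Proof.
move=> cU [gs out L l lam gsk mT fr inj _ E].
have [lq|nlq] := boolP (live out q).
  have [w wq] := live_out lq.
  have [c [a Uc]] := rep1P (clifford_mul cU (rep1_clifford (L w))).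
  apply: (@NormalForm _ _ _ _ _ gs out (upd L w c) l (lam * a)) => //.
    move=> w' tw; have [zw ow Lw] := fr w' tw; split=> //.
    by rewrite upd_other //; apply/eqP => e; rewrite -e ow in wq.
  move=> x; set P := \prod_q' _.
  have EP b : \prod_q' idle_factor out l (set_bit x q b) q' = P.
    by apply: eq_bigr => q' _; rewrite idle_factor_set.
  rewrite amp_act1 big_bool !E !(out_covectors_set _ _ _ inj wq) !EP.
  rewrite (_ : out_covectors (upd L w c) out x =
    upd (out_covectors L out x) w (entry1 (rep1 c) (x q))); last first.
    apply: funext => w'; rewrite /out_covectors /upd; case: eqP => [->|//].
    by rewrite wq.
  set v := out_covectors L out x.
  (* Linearity in wire [w] turns the sum over the bit into one contraction with a row of the merged
     operator. *)
  have := multilinearZ v w a (entry1 (rep1 c) (x q)) mT.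
  rewrite (_ : (fun d => _) = fun d => \sum_b entry1 U (x q) b * entry1 (rep1 (L w)) b d).
    rewrite mT !big_bool /= => H.
    transitivity (lam * (a * contract gs (upd v w (entry1 (rep1 c) (x q)))) * P); last by ring.
    by rewrite -H; ring.
  by apply: funext => d; rewrite -entry1_mul Uc /entry1 mxE.
have [c [a Uc]] := rep1P (clifford_mul cU (rep1_clifford (l q))).
apply: (@NormalForm _ _ _ _ _ gs out L (upd l q c) (lam * a)) => //.
move=> x; rewrite amp_act1.
have Ev b : out_covectors L out (set_bit x q b) = out_covectors L out x.
  apply: out_covectors_ext => p lp; rewrite ffunE; case: eqP => // pq.
  by move: nlq; rewrite -pq lp.
set P := \prod_(q' | q' != q) idle_factor out (upd l q c) x q'.
have EP b : \prod_q' idle_factor out l (set_bit x q b) q' = entry1 (rep1 (l q)) b false * P.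
  rewrite (bigD1 q) //= {1}/idle_factor (negPf nlq) ffunE eqxx; congr (_ * _).
  by apply: eq_bigr => q' h; rewrite /idle_factor ffunE (negPf h) upd_other.
rewrite big_bool !E !Ev !EP (bigD1 q) //= -/P {1}/idle_factor (negPf nlq) upd_same.
have := congr1 (fun V => entry1 V (x q) false) Uc; rewrite entry1_mul big_bool.
rewrite (_ : entry1 (a *: _) _ _ = a * entry1 (rep1 c) (x q) false); last by rewrite /entry1 mxE.
move=> /= H.
set T := contract _ _.
transitivity (lam * T * P * (a * entry1 (rep1 c) (x q) false)); last by ring.
by rewrite -H; ring.
Qed.

(** A wire that ends in the measured qubit now ends in the bit [b]; if there is none, the idle
    factor at [b] is a constant [d], absorbed in [lam]. *)
Lemma normal_form_project m t k (q : 'I_m.+1) b (psi : qstate C m.+1) :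
  normal_form t k [::] psi -> normal_form t k [::] (project q b psi).
Proof.
move=> [gs out L l lam gsk mT fr inj _ E].
pose out' w : bool + 'I_m := match out w with
  | inl c => inl c
  | inr p => if unlift q p is Some i then inr i else inl b end.
have out'P w i : (out' w == inr i) = (out w == inr (lift q i)).
  rewrite /out'; case: (out w) => [c|p]; first by apply/eqP/eqP.
  case: unliftP => [j ->|->].
    by rewrite !inr_eq (inj_eq (@lift_inj _ _)).
  by rewrite inr_eq (negPf (neq_lift q i)).
pose d := if live out q then 1 else entry1 (rep1 (l q)) b false.
apply: (@NormalForm _ _ _ _ _ gs out' L (fun i => l (lift q i)) (lam * d)) => //.
- by move=> w tw; have [zw ow Lw] := fr w tw; rewrite /out' ow.
- move=> w w' i /eqP + /eqP; rewrite !out'P => /eqP + /eqP; exact: inj.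
move=> x; rewrite amp_project E (bigD1_ord q) //= {1}/idle_factor /insert_bit ffunE unlift_none -/d.
rewrite -!mulrA; congr (_ * _); rewrite [RHS]mulrCA; congr (_ * (_ * _)).
  congr (contract gs _); apply: funext => w; rewrite /out_covectors /out'.
  case: (out w) => [//|p] /=; rewrite ffunE.
  by case: (unlift q p).
apply: eq_bigr => i _; rewrite /idle_factor ffunE liftK.
rewrite (_ : live out _ = live out' i) //.
by apply: eq_existsb => w; rewrite out'P.
Qed.

(** Prepares a two-qubit gate: an idle qubit moves with its local Clifford to the fresh wire [t].
    The counter advances in either case, so each gate accounts for two wires. *)
Lemma normal_form_touch m t k A q (psi : qstate C m) : (t < N)%N ->
  normal_form t k A psi -> normal_form t.+1 k (q :: A) psi.
Proof.
move=> tN [gs out L l lam gsk mT fr inj lv E].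
have [lq|nlq] := boolP (live out q).
  apply: (NormalForm gsk mT _ inj _ E) => [w tw|p]; first by apply: fr; apply: ltnW.
  by rewrite inE => /predU1P[->//|]; exact: lv.
pose w0 := Ordinal tN; have [z0 o0 L0] := fr w0 (leqnn _).
have qE w : out w != inr q by apply: contra nlq => h; apply/existsP; exists w.
apply: (@NormalForm _ _ _ _ _ gs (upd out w0 (inr q)) (upd L w0 (l q)) l lam) => //.
- move=> w tw; have [zw ow Lw] := fr w (ltnW tw).
  by rewrite !upd_other // -val_eqE /= gtn_eqF.
- move=> w w' p; rewrite /upd; case: eqP => [->|_]; case: eqP => [->|_] //.
  + by move=> [<-] /eqP; rewrite (negPf (qE _)).
  + by move=> /eqP + [e]; rewrite -e (negPf (qE _)).
  + exact: inj.
- move=> p; rewrite inE => /predU1P[->|/lv /live_out[w wp]]; apply/existsP.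
    by exists w0; rewrite upd_same.
  exists w; rewrite upd_other ?wp //.
  by apply/eqP => e; rewrite e o0 in wp.
move=> x; rewrite E (bigD1 q) //= [in RHS](bigD1 q) //= {1 3}/idle_factor (negPf nlq).
rewrite (_ : live (upd _ _ _) q); last by apply/existsP; exists w0; rewrite upd_same.
rewrite mul1r mulrA -[lam * _ * _]mulrA; congr (lam * _ * _); last first.
  apply: eq_bigr => p pq; rewrite /idle_factor (_ : live out p = live (upd out w0 (inr q)) p) //.
  apply: eq_existsb => w; rewrite /upd; case: (eqVneq w w0) => [->|//].
  by rewrite o0 inr_eq [q == p]eq_sym (negPf pq).
(* As wire [t] is in the zero state, its new covector contributes exactly the former idle factor of
   [q]. *)
set v := out_covectors _ _ _; rewrite mulrC.
have := z0 v (entry1 (rep1 (l q)) (x q)).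
rewrite (_ : upd v w0 (fun c => (c == false)%:R) = v) => [<-|].
  congr (contract gs _); apply: funext => w; rewrite /v /out_covectors /upd.
  by case: eqP.
apply: funext => w; rewrite /upd; case: eqP => [->|//].
by apply: funext => c; rewrite /v /out_covectors o0 L0 rep1_one entry1_1.
Qed.

(** The pending local Cliffords of both wires are stored with the gate and reset to [one]. The outer
    covectors then are basis covectors, which select the terms [a = x q] and [b = x q']. *)
Lemma normal_form_gate2 m t k (q q' : 'I_m) U (psi : qstate C m) : q != q' -> clifford U ->
  normal_form t k [:: q; q'] psi -> normal_form t k.+1 [::] (act_on [tuple q; q'] U *m psi).
Proof.
move=> qq' cU [gs out L l lam gsk mT fr inj lv E].
have lq : live out q by apply: lv; rewrite inE eqxx.
have lq' : live out q' by apply: lv; rewrite !inE eqxx orbT.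
have [w wq] := live_out lq; have [w' wq'] := live_out lq'.
have ww' : w != w' by apply: contraNneq qq' => e; move: wq; rewrite e wq' => -[->].
have [u [a Uu]] := rep2P cU.
have fw (s : 'I_N) : (t <= s)%N -> s != w /\ s != w'.
  move=> ts; have [_ os _] := fr s ts.
  by split; apply/eqP => e; [move: wq | move: wq']; rewrite -e os.
apply: (@NormalForm _ _ _ _ _ (Some (w, w', u, (L w, L w')) :: gs) out
          (upd (upd L w one) w' one) l (lam * a)) => //.
- exact: apply_gate_multilinear.
- move=> s ts; have [zs os Ls] := fr s ts; have [sw sw'] := fw s ts.
  by split=> //; [exact: apply_gate_zero_at | rewrite !upd_other].
move=> x; rewrite amp_act2 //; set P := \prod_p _; set v := out_covectors _ _ _.
have EP c d : \prod_p idle_factor out l (set_bit (set_bit x q c) q' d) p = P.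
  by apply: eq_bigr => p _; rewrite !idle_factor_set.
have vE c d : upd (upd (out_covectors L out x) w (entry1 (rep1 (L w)) c)) w' (entry1 (rep1 (L w')) d) =
   upd (upd v w (entry1 (rep1 (L w)) c)) w' (entry1 (rep1 (L w')) d).
  apply: funext => s; rewrite /upd; case: eqP => // sw'; case: eqP => // sw.
  by rewrite /v /out_covectors /upd; case: eqP => // _; case: eqP.
have v0 c : v w c = (c == x q)%:R.
  by rewrite /v /out_covectors upd_other // upd_same rep1_one entry1_1 wq.
have v1 c : v w' c = (c == x q')%:R.
  by rewrite /v /out_covectors upd_same rep1_one entry1_1 wq'.
have Epsi c d : amp psi (set_bit (set_bit x q c) q' d) = lam * contract gs
    (upd (upd v w (entry1 (rep1 (L w)) c)) w' (entry1 (rep1 (L w')) d)) * P.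
  by rewrite E EP (out_covectors_set _ _ _ inj wq') (out_covectors_set _ _ _ inj wq) vE.
have eE c d : entry2 (a *: rep2 u) (x q) (x q') c d = a * entry2 (rep2 u) (x q) (x q') c d.
  by rewrite /entry2 mxE.
rewrite Uu /= /apply_gate !big_bool !eE !Epsi !v0 !v1.
by case: (x q); case: (x q'); rewrite /=; ring.
Qed.

(** Follows one branch along which success keeps nonzero probability. With [k] gates applied, at
    most [k.*2] wires are in use, so [K.*2] wires suffice. *)
Lemma normal_form_output n K (P : qstate C n -> Prop) m (A : algorithm C n m) k psi :
  N = K.*2 -> (k + CZ_complexity A <= K)%N -> normal_form k.*2 k [::] psi ->
  output_prob P A psi != 0 -> exists psi', P psi' /\ normal_form K.*2 K [::] psi'.
Proof.
move=> NK; elim: A k psi => {m} [|m q A IH|m q U cU A IH|m q q' qq' U cU A IH] k psi /= kK nf.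
- case: asboolP => [Pp _|_]; last by rewrite eqxx.
  exists psi; split=> //; rewrite addn0 in kK.
  by apply: normal_form_weaken nf; rewrite ?leq_double.
- move=> ne; have [b nb] : exists b, output_prob P (A b) (post_state q b psi) != 0.
    apply: contrapT => H; case/eqP: ne; apply: big1 => b _.
    have [->|nb] := eqVneq (output_prob P (A b) (post_state q b psi)) 0; first by rewrite mulr0.
    by case: H; exists b.
  apply: (IH b k) nb; last by apply: normal_form_scale; apply: normal_form_project.
  by apply: leq_trans kK; rewrite leq_add2l; exact: (leq_bigmax b).
- by apply: (IH k) => //; apply: normal_form_gate1.
- apply: (IH k.+1); first by rewrite addSnnS.
  have tN : (k.*2.+1 < N)%N.
    by rewrite NK -doubleS leq_double; apply: leq_trans kK; rewrite addnS ltnS leq_addr.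
  apply: normal_form_gate2 => //; rewrite doubleS.
  exact: (normal_form_touch q tN (normal_form_touch q' (ltnW tN) nf)).
Qed.

End NormalForm.

(** * Recovering the graph *)

Definition unit_bits n (v : 'I_n) : bits n := [ffun k => k == v].
Definition zero_bits n : bits n := [ffun=> false].

(** * Amplitudes of graph states *)

Section GraphStates.
Variables (C : numClosedFieldType) (n : nat) (G : sgraph 'I_n) (psi : qstate C n).
Hypothesis Gpsi : is_graph_state G psi.

(** The stabilizer equation of [v] read at [x]: [X] flips bit [v], and the [Z] factors give the
    signs. *)
Lemma graph_state_flip v x : amp psi x =
  (\prod_(w | w != v) if G v w then (-1) ^+ x w else 1) * amp psi (xor_bits (unit_bits v) x).
Proof.
have [_ /(_ v) e] := Gpsi.
pose p w (a : bool) : C := if w == v then 1 else if G v w then (-1) ^+ a else 1.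
have hs : monomial (fun w => if w == v then pauliX C else if G v w then pauliZ C else 1%:M)
    (unit_bits v) p.
  move=> w a b; rewrite /p ffunE; case: eqP => _; first by rewrite pauliXE addbT mulr1.
  by rewrite addbF; case: (G v w); rewrite ?pauliZE // pauli1E mulr1.
rewrite /amp -[in LHS]e (tensor_mul hs) bits_indexK; congr (_ * _).
rewrite (bigD1 v) //= {1}/p eqxx mul1r; apply: eq_bigr => w wv.
by rewrite /p (negPf wv).
Qed.

Lemma graph_state_unit v : amp psi (unit_bits v) = amp psi (zero_bits n).
Proof.
rewrite [RHS](graph_state_flip v) big1 ?mul1r => [|w _]; last by rewrite ffunE expr0 if_same.
by congr (amp psi _); apply/ffunP => k; rewrite !ffunE.
Qed.

Lemma graph_state_pair v w : v != w ->
  amp psi (xor_bits (unit_bits v) (unit_bits w)) = (-1) ^+ G v w * amp psi (zero_bits n).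
Proof.
move=> vw; rewrite -(graph_state_unit w) [in RHS](graph_state_flip v).
rewrite (bigD1 w) 1?eq_sym //= big1 ?mulr1 => [|u /andP[_ uw]]; last first.
  by rewrite ffunE (negPf uw) expr0 if_same.
rewrite ffunE eqxx mulrA; case: (G v w); rewrite ?expr0 ?expr1 ?mulr1 ?mul1r //.
by rewrite mulrNN mulr1 mul1r.
Qed.

(** Otherwise, removing ones by flips shows by induction that every amplitude vanishes, against the
    unit norm. *)
Lemma graph_state_neq0 : amp psi (zero_bits n) != 0.
Proof.
apply/eqP => z; have E x : amp psi x = 0.
  have [k] := ubnP #|[pred q | x q]|; elim: k x => // k IH x xk.
  have [v xv|x0] := pickP (fun q => x q); last first.
    by rewrite (_ : x = zero_bits n) //; apply/ffunP => q; rewrite x0 ffunE.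
  rewrite (graph_state_flip v) IH ?mulr0 //; move: xk; rewrite !ltnS; apply: leq_trans.
  apply: proper_card; apply/fintype.properP; split; last first.
    by exists v; rewrite !inE ?xv // !ffunE eqxx xv.
  apply/fintype.subsetP => q; rewrite !inE !ffunE.
  by case: eqP => [->|_]; rewrite ?xv ?addbF.
have [/eqP + _] := Gpsi; rewrite /sq_norm big1 => [|i _].
  by rewrite eq_sym oner_eq0.
by have := E (index_bits i); rewrite /amp index_bitsK => ->; rewrite normr0 expr0n.
Qed.

(** Adjacency is the sign between two nonzero amplitudes, so it can be read off from the state up to
    a scalar. *)
Lemma graph_stateE v w : v != w ->
  G v w = (amp psi (xor_bits (unit_bits v) (unit_bits w)) != amp psi (zero_bits n)).
Proof.
move=> vw; rewrite (graph_state_pair vw); case: (G v w); rewrite ?expr1 ?expr0 ?mul1r ?eqxx //.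
apply/esym/negP; rewrite mulN1r eq_sym -addr_eq0 -mulr2n mulrn_eq0.
by rewrite (negPf graph_state_neq0).
Qed.

End GraphStates.

(** * Counting graphs by the finite data of a normal form *)

Section Decode.
Variable C : numClosedFieldType.
Variables (F1 F2 : finType) (rep1 : F1 -> qop C 1) (rep2 : F2 -> qop C 2) (one : F1).
Variable N : nat.

(** The test omits [lam] and the idle factors, which range over no finite set or are not recorded;
    vertices without a wire count as isolated. *)
Definition decode n (gs : seq (option ('I_N * 'I_N * F2 * (F1 * F1))))
    (L : 'I_N -> F1) (out : 'I_N -> bool + 'I_n) v w : bool :=
  let A x := contract rep1 rep2 gs (out_covectors rep1 L out x) in
  [&& live out v, live out w
    & A (xor_bits (unit_bits v) (unit_bits w)) != A (zero_bits n)].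

Lemma graph_state_decode n (G : sgraph 'I_n) psi t k A : is_graph_state G psi ->
  @normal_form C F1 F2 rep1 rep2 one N n t k A psi ->
  exists gs (L : 'I_N -> F1) (out : 'I_N -> bool + 'I_n), (size gs <= k)%N /\
    forall v w, v != w -> G v w = decode gs L out v w.
Proof.
move=> Gpsi [gs out L l lam gsk _ _ _ _ E]; exists gs, L, out; split=> // v w vw.
pose P x := \prod_q idle_factor rep1 out l x q.
pose T x := contract rep1 rep2 gs (out_covectors rep1 L out x).
have {}E x : amp psi x = lam * T x * P x by exact: E.
have n0 := graph_state_neq0 Gpsi.
pose o := zero_bits n; pose e := @unit_bits n.
have TP (x y : bits n) : (forall q, live out q -> x q = y q) -> T x = T y.
  by move=> xy; rewrite /T (out_covectors_ext _ _ xy).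
(* If [u1] is idle, the product form makes the amplitudes at [u1 + u2] and 0 multiply to those at
   [u1] and [u2]. Unit strings have the amplitude of 0, so [u1] and [u2] are not adjacent. *)
have idle u1 u2 : u1 != u2 -> ~~ live out u1 -> amp psi (xor_bits (e u1) (e u2)) = amp psi o.
  move=> u12 nl1; apply: (mulfI n0).
  rewrite -{2}(graph_state_unit Gpsi u1) -{2}(graph_state_unit Gpsi u2) !E.
  have lu q : live out q -> q != u1 by apply: contraTneq => ->.
  rewrite (TP (xor_bits (e u1) (e u2)) (e u2)) => [|q /lu /negPf h]; last first.
    by rewrite !ffunE h addbF.
  rewrite (TP (e u1) o) => [|q /lu /negPf h]; last by rewrite !ffunE h.
  have PP : P o * P (xor_bits (e u1) (e u2)) = P (e u1) * P (e u2).
    rewrite /P -!big_split; apply: eq_bigr => q _; rewrite /idle_factor /= !ffunE.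
    case: ifP => // _; have [->|_] := eqVneq q u1; last by rewrite addbF.
    by rewrite (negPf u12) mulrC.
  by rewrite mulrACA PP mulrACA.
rewrite (graph_stateE Gpsi vw) /decode.
have [lv|nlv] := boolP (live out v); last by rewrite idle ?eqxx.
have [lw|nlw] := boolP (live out w); last first.
  rewrite (_ : xor_bits _ _ = xor_bits (e w) (e v)) ?idle ?eqxx 1?eq_sym //.
  by apply/ffunP => q; rewrite !ffunE addbC.
(* For two live vertices the idle factors agree at both strings and cancel, together with [lam]. *)
have PE : P (xor_bits (e v) (e w)) = P o.
  apply: eq_bigr => q _; rewrite /idle_factor; case: ifP => // lq.
  rewrite !ffunE; have [qv|_] := eqVneq q v; first by rewrite qv lv in lq.
  by have [qw|_] := eqVneq q w; first by rewrite qw lw in lq.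
rewrite !E PE /=; rewrite E in n0.
have [l0 P0] : lam != 0 /\ P o != 0.
  by move: n0; rewrite !mulf_eq0 !negb_or => /andP[/andP[-> _] ->].
by rewrite (inj_eq (mulIf P0)) (inj_eq (mulfI l0)).
Qed.

Lemma contract_pad gs k :
  contract rep1 rep2 (nseq k None ++ gs) = contract rep1 rep2 gs :> (('I_N -> bool -> C) -> C).
Proof. by elim: k. Qed.

End Decode.

(** The code of a graph has [K] optional gates and, for each of [K.*2] wires, a local class and an
    end among [n] qubits and two bits. The number [s] of ancillas does not enter, as only touched
    qubits get wires. *)
Lemma card_generated (C : numClosedFieldType) : exists b : nat, (0 < b)%N /\
  forall n K (I : finType) (Gr : I -> sgraph 'I_n),
  (forall i j, Gr i =2 Gr j -> i = j) ->
  (forall i, exists s (A : algorithm C n (n + s)), generates A (Gr i) /\ (CZ_complexity A <= K)%N) ->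
  (#|I| <= (K.*2 * K.*2 * b).+1 ^ K * (b * (n + 2)) ^ K.*2)%N.
Proof.
have [F1 [rep1 [one [c1 r1 p1]]]] := clifford_finite C 1.
have [F2 [rep2 [_ [_ _ p2]]]] := clifford_finite C 2.
(* The sum dominates both the choices of Clifford classes in a gate and those of a local class. *)
exists (#|F2| * (#|F1| * #|F1|) + #|F1|)%N; split.
  by rewrite addn_gt0 orbC; apply/orP; left; apply/card_gt0P; exists one.
move=> n K I Gr Ginj Hgen.
pose N := K.*2; pose gate := ('I_N * 'I_N * F2 * (F1 * F1))%type.
pose code := (K.-tuple (option gate) * {ffun 'I_N -> F1 * (bool + 'I_n)})%type.
pose dec (d : code) := decode rep1 rep2 d.1 (fun w => (d.2 w).1) (fun w => (d.2 w).2).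
have /choice[d dP] : forall i, exists d : code, forall v w, v != w -> Gr i v w = dec d v w.
  move=> i; have [s [A [gA cA]]] := Hgen i.
  have [||||psi [Gpsi nf]] := normal_form_output c1 r1 p1 p2 (N := N) (K := K) (k := 0)
      (P := is_graph_state (Gr i)) (A := A) (psi := zero_state C (n + s)) _ _ _ _.
  - by [].
  - by [].
  - exact: normal_form_zero.
  - by rewrite gA oner_eq0.
  have [gs [L [out [sgs E]]]] := graph_state_decode Gpsi nf.
  have st : size (nseq (K - size gs) None ++ gs) == K by rewrite size_cat size_nseq subnK.
  exists (Tuple st, [ffun w => (L w, out w)]) => v w vw; rewrite E // /dec /decode /=.
  rewrite contract_pad.
  have -> : (fun w0 => ([ffun w1 => (L w1, out w1)] w0).1) = L by apply: funext => w'; rewrite ffunE.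
  suff -> : (fun w0 => ([ffun w1 => (L w1, out w1)] w0).2) = out by [].
  by apply: funext => w'; rewrite ffunE.
have dinj : injective d.
  move=> i j ij; apply: Ginj => v w; have [->|vw] := eqVneq v w; first by rewrite !adj_irrefl.
  by rewrite !dP // ij.
apply: leq_trans (leq_card d dinj) _.
rewrite card_prod card_tuple card_option card_ffun !card_prod card_sum !card_ord card_bool.
have le_exp a b c : (a <= b)%N -> (a ^ c <= b ^ c)%N by case: c => // c; rewrite leq_exp2r.
apply: leq_mul; apply: le_exp; last by apply: leq_mul; [exact: leq_addl | rewrite addnC].
by rewrite ltnS -mulnA leq_mul // leq_addr.
Qed.

(** * The lower bound *)

(** Constants are absorbed by [x <= n ^ x]. A gate costs the exponent [5 * b + 4] and each of its
    two wires [2 * b + 1], in total [9 * b + 6]. *)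
Lemma count_bound (b n K : nat) : (0 < b -> 1 < n -> K <= n * n ->
  (K.*2 * K.*2 * b).+1 ^ K * (b * (n + 2)) ^ K.*2 <= n ^ ((9 * b + 6) * K))%N.
Proof.
move=> b0 n1 Kn.
have le_exp x y z : (x <= y)%N -> (x ^ z <= y ^ z)%N by case: z => // z; rewrite leq_exp2r.
have le_self x : (x <= n ^ x)%N by apply: ltnW; apply: ltn_expl.
have h1 : ((K.*2 * K.*2 * b).+1 <= n ^ (5 * b + 4))%N.
  apply: (@leq_trans (5 * b * n ^ 4)%N); last by rewrite expnD leq_mul.
  have : (K * K <= n ^ 4)%N by rewrite (expnD n 2 2) -!mulnn leq_mul.
  move: (n ^ 4)%N (expn_gt0 n 4) => q; rewrite (ltnW n1) /= => q0 KK.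
  have : (K * K * b <= q * b)%N by rewrite leq_mul.
  have : (0 < q * b)%N by rewrite muln_gt0 q0.
  by rewrite -!mul2n; move: (q * b)%N (K * K * b)%N; nia.
have h2 : (b * (n + 2) <= n ^ (2 * b + 1))%N.
  apply: (@leq_trans (2 * b * n)%N); first by nia.
  by rewrite expnD expn1 leq_mul.
apply: leq_trans (leq_mul (le_exp _ _ K h1) (le_exp _ _ K.*2 h2)) _.
by rewrite -!expnM -expnD leq_pexp2l ?(ltnW n1) // -mul2n; nia.
Qed.

Theorem lemma6 (R : realType) :
  exists c : R, 0 < c /\
    forall n r : nat, (2 <= n)%N -> (r%:Z <= Num.ceil (n%:R / 3 : R)) ->
      exists G : sgraph 'I_n,
        (rank_width R G <= (r%:R)%:E)%E /\
        ((c * r%:R * n%:R / ln n%:R)%:E <= Gamma_CZ R G)%E.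
Proof.
have [b [b0 count]] := card_generated (R [i])%C.
pose a := (9 * b + 6)%N.
have ln2 : 0 < ln 2 :> R by rewrite ln_gt0 // ltr1n.
have a0 : 0 < a%:R :> R by rewrite ltr0n addn_gt0 orbT.
(* One factor 2 pays for [n <= 2 * (n - r)]; the other makes the final comparison of powers of [n]
   strict unless [K = 0]. *)
exists (ln 2 / (4 * a%:R)); split; first by rewrite divr_gt0 // mulr_gt0.
move=> n r n2 rn.
(* The ceiling gives [3 * r < n + 3], which over the integers with [n >= 2] implies [2 * r <= n]. *)
have r2n : (r.*2 <= n)%N.
  have : (r%:R : R) < n%:R / 3 + 1.
    apply: le_lt_trans (_ : ((Num.ceil (n%:R / 3 : R))%:~R : R) < _).
      by rewrite -[r%:R]/((r%:Z)%:~R) ler_int.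
    by rewrite -ltrBlDr -[X in _ - X]/(1%:~R) -intrB ceilB1_lt.
  rewrite -(ltr_pM2r (x := 3)) // mulrDl divfK // mul1r -natrM -natrD ltr_nat; lia.
(* If the claim fails, every band graph is generated with fewer than [x] two-qubit gates. *)
apply: contrapT => noG.
have gen (f : {ffun 'I_(n - r) * 'I_r -> bool}) : exists s (A : algorithm R[i]%C n (n + s)),
    generates A (band_graph f) /\
    (CZ_complexity A)%:R < ln 2 / (4 * a%:R) * r%:R * n%:R / ln n%:R :> R.
  apply: contrapT => nogen; apply: noG; exists (band_graph f); split.
    by apply: rank_width_le => // u v; exact: band_graph_width.
  apply: le_ereal_inf_tmp => _ [_ [s [A [gA <-]]] <-].
  rewrite lee_fin leNgt; apply/negP => lt; apply: nogen.
  by exists s, A.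
set x := ln 2 / _ * _ * _ / _ in gen.
have lnn : 0 < ln n%:R :> R by rewrite ln_gt0 // ltr1n.
have x0 : 0 <= x by rewrite /x !mulr_ge0 ?invr_ge0 ?mulr_ge0 // ltW.
pose K := Num.truncn x.
have Kx : K%:R <= x by rewrite -truncn_ge_nat.
(* For [r = 0] the bound is 0, and no complexity lies below it. *)
have r0 : (0 < r)%N.
  have [s [A [_ lt]]] := gen [ffun=> false].
  rewrite lt0n; apply: contraTneq lt => r0.
  by rewrite -leNgt /x r0 mulr0 mul0r mul0r ler0n.
(* This is [K <= x] multiplied by [4 * a * ln n] and exponentiated. *)
have K4 : (n ^ (4 * a * K) <= 2 ^ (r * n))%N.
  rewrite -(ler_nat R) !natrX -ler_ln ?posrE ?exprn_gt0 ?ltr0n // ?(ltnW n2) //.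
  rewrite !lnXn ?ltr0n ?(ltnW n2) // -![ln _ *+ _]mulr_natr !natrM.
  have : K%:R * (ln n%:R * (4 * a%:R)) <= x * (ln n%:R * (4 * a%:R)).
    by rewrite ler_wpM2r // mulr_ge0 ?mulr_ge0 // ltW.
  rewrite (_ : x * _ = ln 2 * (r%:R * n%:R)); last by rewrite /x; field; lra.
  by apply: le_trans; rewrite le_eqVlt; apply/orP; left; apply/eqP; ring.
have Kn : (K <= n * n)%N.
  have : (2 ^ K <= 2 ^ (r * n))%N.
    apply: leq_trans K4; apply: (@leq_trans (n ^ K)); first by case: (K) => // k; rewrite leq_exp2r.
    by rewrite leq_pexp2l ?(ltnW n2) // leq_pmull // muln_gt0 /a; lia.
  by rewrite leq_exp2l // => h; apply: leq_trans h _; rewrite leq_mul //; lia.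
have big : (2 ^ (r * (n - r)) <= n ^ (a * K))%N.
  apply: leq_trans (count_bound b0 n2 Kn).
  have := count n K _ (@band_graph n r) (@band_graph_inj n r).
  rewrite card_ffun card_bool card_prod !card_ord mulnC; apply => f.
  have [s [A [gA lt]]] := gen f; exists s, A; split=> //.
  by rewrite truncn_ge_nat // ltW.
(* After squaring: [n ^ (4aK) <= 2 ^ (rn) <= 2 ^ (2r(n - r)) <= n ^ (2aK)], which forces [K = 0]. *)
have : (n ^ (2 * a * K) <= n ^ (a * K))%N.
  apply: leq_trans big; rewrite -(@leq_exp2r _ _ 2) // -!expnM.
  apply: leq_trans (leq_trans K4 _); first by rewrite leq_pexp2l ?(ltnW n2) //; nia.
  by rewrite leq_pexp2l //; nia.
rewrite leq_exp2l // => aK; have K0 : K = 0%N by move: aK; rewrite /a; nia.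
(* With [K = 0] the count allows a single graph, but the family has at least two. *)
move: big; rewrite K0 muln0 expn0 leqNgt -[X in (X < _)%N](expn0 2) ltn_exp2l //.
by rewrite muln_gt0 r0 subn_gt0 /=; lia.
Qed.
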